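(* Let $G=(K,S,E(G))$ be a split graph on $n$ vertices. If $\delta(G)\ge \frac{3n}{5}$, then $\tau(G)\le 2\,\nu(G)$.
   Context: A split graph $G=(K,S,E(G))$ is a graph whose vertex set is partitioned into a clique $K$ and an independent set $S$. $\delta(G)$ is the minimum degree of $G$. A triangle hitting of $G$ is a set of edges whose removal leaves a triangle-free graph, and $\tau(G)$ is the minimum size of a triangle hitting; a triangle packing is a set of pairwise edge-disjoint triangles, and $\nu(G)$ is the maximum size of a triangle packing. *)

(* Defs.v *)
From mathcomp Require Import all_boot.

Set Implicit Arguments.
Unset Strict Implicit.
Unset Printing Implicit Defensive.

(* A graph is an adjacency relation on a finite vertex type;
   edges and triangles are the corresponding 2-sets and 3-sets of vertices. *)
Section Graphs.
Variable T : finType.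
Implicit Types (e : rel T) (K S : {set T}) (F P : {set {set T}}).

Definition simple_graph e : Prop := symmetric e /\ irreflexive e.

Definition edges e : {set {set T}} :=
  [set [set x; y] | x in [set: T], y in [set: T] & e x y].

Definition clique e K : Prop := {in K &, forall x y, x != y -> e x y}.

Definition independent e S : Prop := {in S &, forall x y, ~~ e x y}.

(* K and S may be empty, so this is not finset's [partition]. *)
Definition split_graph e K S : Prop :=
  [/\ simple_graph e, K :|: S = [set: T], [disjoint K & S],
      clique e K & independent e S].

Definition degree e (x : T) : nat := #|[set y | e x y]|.

(* The default value #|T| exceeds every degree of a simple graph, so it is
   taken only when there are no vertices. *)
Definition min_degree e : nat := \big[minn/#|T|]_(x : T) degree e x.

Definition triangles e : {set {set T}} :=
  [set t : {set T} | (#|t| == 3) &&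
     [forall x in t, forall y in t, (x != y) ==> e x y]].

Definition triangle_free e : bool := triangles e == set0.

Definition remove_edges e F : rel T :=
  [rel x y | e x y && ([set x; y] \notin F)].

Definition triangle_hitting e F : bool :=
  (F \subset edges e) && triangle_free (remove_edges e F).

(* The default value is attained: the whole edge set is a triangle hitting. *)
Definition tau e : nat :=
  \big[minn/#|edges e|]_(F : {set {set T}} | triangle_hitting e F) #|F|.

Definition triangle_edges e (t : {set T}) : {set {set T}} :=
  [set f in edges e | f \subset t].

Definition triangle_packing e P : bool :=
  (P \subset triangles e) &&
  [forall t1 in P, forall t2 in P,
     (t1 != t2) ==> [disjoint triangle_edges e t1 & triangle_edges e t2]].

Definition nu e : nat :=
  \max_(P : {set {set T}} | triangle_packing e P) #|P|.

End Graphs.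

(* Main.v *)
Require Import Defs.
From mathcomp Require Import all_boot zify.
From Stdlib Require Import ZArith.

(* Label the n vertices by Z/n and sort the triangles by the sum of their
   labels: two triangles sharing an edge have different sums, so each of the n
   classes is a packing and n nu(G) is at least the number of triangles, which
   is at least C(|K|,3) + sum_(s in S) C(d(s),2).
   On the other side, deleting the edges inside K, or the monochromatic edges
   of a 2-colouring of the vertices, destroys all triangles. Halving K into A
   and K \ A and giving each s in S the colour it sees less often yields
   tau(G) <= C(|A|,2) + C(|K \ A|,2) + sum_s min(d_A(s), d_(K \ A)(s)).
   Bounding each minimum by d(s)/2, these estimates suffice when d(s) >= 3n/5,
   except for seven pairs (n, |K|); for those, A is chosen so as to contain all
   the non-neighbours in K of three vertices of S, which makes their minima
   smaller. *)

Set Implicit Arguments.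
Unset Strict Implicit.
Unset Printing Implicit Defensive.

(** * Numerical inequalities in n, |K| and the degree bound *)

Lemma mul_2bin2 m : 2 * 'C(m, 2) = m * m.-1.
Proof. by rewrite mulnC (bin_ffact m 2) /falling_factorial /= muln1. Qed.

Section Arith.
Local Open Scope Z_scope.

(** This is 300 times the second case of [bipartition_arith], with the edges inside the two halves
    of K bounded by (k - 1)^2 / 4 and D (D - 1) - n [D./2] bounded below by 3 n (n - 10) / 50. *)
Lemma bipartition_cubic (n k : Z) :
  50 <= n -> 3 * n <= 5 * k ->
  75 * n * ((k - 1) * (k - 1)) - 300 * n <
    100 * (k * (k - 1) * (k - 2)) + 18 * ((n - k) * (n * (n - 10))).
Proof.
move=> n50 kn.
(* After 5 k = 3 n + y, 25 times the difference of the two sides is a sum of terms that are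
   nonnegative once [50 <= n]. *)
have [y y0 ky] : exists2 y, 0 <= y & 5 * k = 3 * n + y.
  by exists (5 * k - 3 * n); lia.
have n0 : 0 <= n by lia.
have n50' : 0 <= n - 50 by lia.
have n2 : 0 <= n * n * (n - 50)
 
  by apply: Z.mul_nonneg_nonneg; [exact: Z.square_nonneg|].
have y2 : 0 <= y * y * (n - 50)
 
  by apply: Z.mul_nonneg_nonneg; [exact: Z.square_nonneg|].
have ny1 : 0 <= n * ((y - 1) * (y - 1))
  by apply: Z.mul_nonneg_nonneg; [|exact: Z.square_nonneg].
have ny2 : 0 <= n * (y * y)
  by apply: Z.mul_nonneg_nonneg; [|exact: Z.square_nonneg].
have y3 : 0 <= y * (y * y)
  by apply: Z.mul_nonneg_nonneg; [|exact: Z.square_nonneg].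
have E : 25 * (100 * (k * (k - 1) * (k - 2)) + 18 * ((n - k) * (n * (n - 10))) -
             (75 * n * ((k - 1) * (k - 1)) - 300 * n)) =
  20 * (5 * k * (5 * k - 5) * (5 * k - 10)) + 90 * (n * (n - 10) * (5 * n - 5 * k))
  - 75 * (n * ((5 * k - 5) * (5 * k - 5))) + 7500 * n by ring.
rewrite ky in E.
have {}E : 25 * (100 * (k * (k - 1) * (k - 2)) + 18 * ((n - k) * (n * (n - 10))) -
             (75 * n * ((k - 1) * (k - 1)) - 300 * n)) =
  45 * (n * n * (n - 50)) + 6 * (y * y * (n - 50)) + 75 * (n * ((y - 1) * (y - 1)))
  + 24 * (n * (y * y)) + 20 * (y * (y * y)) + 8550 * n + 1000 * y.
  by rewrite E; ring.
clear ky; lia.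
Qed.

(* The disjunction of [bipartition_arith] below, multiplied by 3 and with the
   binomials expanded so that it is computed in [Z]. *)
Definition small_ok (n k : Z) : bool :=
  let s := n - k in let D := (3 * n + 4) / 5 in let h := k / 2 in
  let q := (k - 1) * (k - 1) / 4 in
  let P := k * (k - 1) * (k - 2) + 3 * (s * (D * (D - 1))) + 3 * n in
  [|| 3 * n * (k * (k - 1) / 2) <? P, 3 * n * (q + s * (D / 2)) <? P
   | [&& 3 <=? s, 3 * (k - D) <=? h &
      3 * n * (q + (3 * (h - (k - D)) + (s - 3) * (D / 2))) <? P]].

(** Settles by computation the 49 values of n below the range of [bipartition_cubic]. *)
Lemma small_check :
  all (fun n => all (fun k => (Z.of_nat k <? (3 * Z.of_nat n + 4) / 5)
                              || small_ok (Z.of_nat n) (Z.of_nat k))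
                    (iota 0 n.+1))
      (iota 1 49).
Proof. by vm_compute. Qed.

End Arith.

(* [D] is the ceiling of [3n/5], and the third case is needed exactly for
   (n, k) = (10, 7), (13, 9), (16, 11), (20, 13), (20, 14), (23, 15), (30, 20). *)
Lemma bipartition_arith (n k s D h : nat) :
  k + s = n -> D = (3 * n + 4) %/ 5 -> D <= k -> h = k./2 -> 0 < n ->
  [\/ n * 'C(k, 2) < 2 * 'C(k, 3) + s * (D * D.-1) + n,
      n * ('C(h, 2) + 'C(k - h, 2) + s * D./2) < 2 * 'C(k, 3) + s * (D * D.-1) + n
    | [/\ 3 <= s, 3 * (k - D) <= h &
      n * ('C(h, 2) + 'C(k - h, 2) + (3 * (h - (k - D)) + (s - 3) * D./2))
        < 2 * 'C(k, 3) + s * (D * D.-1) + n]].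
Proof.
move=> ks defD Dk defh n0.
have c3 m : 6 * 'C(m, 3) = m * (m.-1 * m.-2).
  by rewrite mulnC (bin_ffact m 3) /falling_factorial /= muln1.
have zc3 : (6 * Z.of_nat 'C(k, 3) = Z.of_nat k * (Z.of_nat k - 1) * (Z.of_nat k - 2))%Z.
  by have := c3 k; case: (k) => [|[|m]]; rewrite ?[_.+1.-1]/=; lia.
have zc2 m : (2 * Z.of_nat 'C(m, 2) = Z.of_nat m * (Z.of_nat m - 1))%Z.
  by have := mul_2bin2 m; case: (m) => [|m']; rewrite ?[_.+1.-1]/=; lia.
(* Halving leaves floor((k - 1)^2 / 4) edges inside the halves; the remainder of this division is 1
   for even k and 0 for odd k. *)
have zq : (Z.of_nat ('C(h, 2) + 'C(k - h, 2)) = (Z.of_nat k - 1) * (Z.of_nat k - 1) / 4)%Z.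
  have := zc2 h; have := zc2 (k - h).
  have [[Ekh Ek] | [Ekh Ek]] : k - h = h /\ k = 2 * h \/ k - h = h.+1 /\ k = 2 * h + 1 by lia.
    by rewrite Ekh Ek => *; apply: (Z.div_unique_pos _ _ _ 1); lia.
  by rewrite Ekh Ek => *; apply: (Z.div_unique_pos _ _ _ 0); lia.
have zck : (Z.of_nat 'C(k, 2) = Z.of_nat k * (Z.of_nat k - 1) / 2)%Z.
  by rewrite -zc2 Z.mul_comm Z.div_mul.
have [n50|n50] := leqP 50 n.
  apply: Or32.
  have hD : 3 * n <= 5 * D by lia.
  have hF : (0 <= 50 * (Z.of_nat D * (Z.of_nat D - 1) - Z.of_nat n * Z.of_nat D./2)
      - 3 * Z.of_nat n * (Z.of_nat n - 10))%Z.
    have F2 : (2 * Z.of_nat D./2 <= Z.of_nat D)%Z by lia.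
    (* This product equals 50 (D (D - 1) - n D / 2) - 3 n (n - 10); the next one accounts for
       rounding D / 2 down. *)
    have : (0 <= (5 * Z.of_nat D - 3 * Z.of_nat n) * (10 * Z.of_nat D + Z.of_nat n - 10))%Z.
      by apply: Z.mul_nonneg_nonneg; lia.
    have : (0 <= Z.of_nat n * (Z.of_nat D - 2 * Z.of_nat D./2))%Z.
      by apply: Z.mul_nonneg_nonneg; lia.
    lia.
  have hsF := Z.mul_nonneg_nonneg _ _ (Zle_0_nat s) hF.
  have q4 : (4 * Z.of_nat ('C(h, 2) + 'C(k - h, 2)) <= (Z.of_nat k - 1) * (Z.of_nat k - 1))%Z.
    by rewrite zq; apply: Z.mul_div_le.
  have hnq : (4 * (Z.of_nat n * Z.of_nat ('C(h, 2) + 'C(k - h, 2))) <= Z.of_nat n * ((Z.of_nat k - 1) * (Z.of_nat k - 1)))%Z.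
    by move: q4; set a := Z.of_nat (_ + _); nia.
  have := @bipartition_cubic (Z.of_nat n) (Z.of_nat k) ltac:(lia) ltac:(lia).
  have -> : (Z.of_nat n - Z.of_nat k = Z.of_nat s)%Z by lia.
  move: hsF hnq zc3; clear; set q := _ + 'C(_, _); clearbody q.
  move: 'C(k, 3) D./2 => c F.
  case: D => [|D']; rewrite ?[_.+1.-1]/=; lia.
have /allP/(_ n) := small_check.
rewrite mem_iota n0 n50 => /(_ isT)/allP/(_ k).
rewrite mem_iota; have -> : 0 <= k < 0 + n.+1 by lia.
move=> /(_ isT); rewrite /small_ok -zck -zq.
have z2 m : (Z.of_nat m / 2 = Z.of_nat m./2)%Z.
  apply/esym/(Z.div_unique_pos _ _ _ (Z.of_nat (odd m))); first by case: odd.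
  by move: (odd_double_half m); lia.
have zF := z2 D.
have zD : ((3 * Z.of_nat n + 4) / 5 = Z.of_nat D)%Z.
  by apply/esym/(Z.div_unique_pos _ _ _ (3 * Z.of_nat n + 4 - 5 * Z.of_nat D)); lia.
have zh : (Z.of_nat k / 2 = Z.of_nat h)%Z by rewrite defh.
have zs : (Z.of_nat n - Z.of_nat k = Z.of_nat s)%Z by lia.
rewrite zD zF zh zs; clear zD zF zh zs zq zck.
case/orP => [|]; first by lia.
case/or3P => [H|H|/and3P[s3 Dh H]]; [apply: Or31|apply: Or32|apply: Or33].
- move: H zc3; case: (D) => [|D']; rewrite ?[_.+1.-1]/=; lia.
- move: H zc3; case: (D) => [|D']; rewrite ?[_.+1.-1]/=; lia.
split; first lia; first lia.
have {}H : (3 * Z.of_nat n * (Z.of_nat ('C(h, 2) + 'C(k - h, 2)) + (3 * Z.of_nat (h - (k - D)) + Z.of_nat (s - 3) * Z.of_nat D./2)) <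
  Z.of_nat k * (Z.of_nat k - 1) * (Z.of_nat k - 2) + 3 * (Z.of_nat s * (Z.of_nat D * (Z.of_nat D - 1))) + 3 * Z.of_nat n)%Z.
  rewrite (_ : Z.of_nat (h - (k - D)) = Z.of_nat h - (Z.of_nat k - Z.of_nat D))%Z; last lia.
  rewrite (_ : Z.of_nat (s - 3) = Z.of_nat s - 3)%Z; last lia.
  exact/Z.ltb_lt.
move: H zc3; set x := h - (k - D); set y := s - 3; clearbody x y.
case: (D) => [|D']; rewrite ?[_.+1.-1]/=; lia.
Qed.

(** * Minima, unions and intermediate sets of prescribed size *)

Lemma bigminn_le (I : finType) (P : pred I) (F : I -> nat) x0 j :
  P j -> \big[minn/x0]_(i | P i) F i <= F j.
Proof.
move=> Pj; have: j \in index_enum I by rewrite mem_index_enum.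
elim: (index_enum I) => // i r IHr; rewrite inE big_cons => /predU1P[<-|/IHr le_r].
  by rewrite Pj geq_minl.
by case: ifP => // _; rewrite geq_min le_r orbT.
Qed.

Lemma leq_card_bigcup (I T : finType) (P : pred I) (F : I -> {set T}) :
  #|\bigcup_(i | P i) F i| <= \sum_(i | P i) #|F i|.
Proof.
elim/big_rec2: _ => [|i m A _ le_Am]; first by rewrite cards0.
by rewrite (leq_trans (leq_card_setU _ _)) // leq_add2l.
Qed.

Lemma superset_of_card (T : finType) (A B : {set T}) m :
  A \subset B -> #|A| <= m <= #|B| ->
  exists C : {set T}, [/\ A \subset C, C \subset B & #|C| = m].
Proof.
move=> sAB /andP[leAm lemB].
have : 0 < #|[set C : {set T} | C \subset B :\: A & #|C| == m - #|A|]|.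
  rewrite cards_draws bin_gt0; have := cardsID A B.
  by rewrite (setIidPr sAB); lia.
rewrite card_gt0 => /set0Pn[C]; rewrite inE => /andP[/subsetDP[sCB disAC] /eqP cC].
exists (A :|: C); rewrite subsetUl subUset sAB sCB; split=> //.
have := cardsUI A C; move: disAC; rewrite disjoint_sym -setI_eq0 => /eqP ->.
by rewrite cards0 cC; lia.
Qed.

(** * Packings and hittings in an arbitrary simple graph *)

Section Graph.
Variables (T : finType) (e : rel T).
Hypothesis simple_e : simple_graph e.
Let sym_e : symmetric e := simple_e.1.
Let irr_e : irreflexive e := simple_e.2.

Lemma edgesP (f : {set T}) :
  reflect (exists x y, e x y /\ f = [set x; y]) (f \in edges e).
Proof.
apply: (iffP imset2P) => [[x y _]|[x [y [exy ->]]]].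
  by rewrite inE => /andP[_ exy] ->; exists x, y.
by exists x y; rewrite ?inE ?exy.
Qed.

Lemma edge_neq x y : e x y -> x != y.
Proof. by apply: contraTneq => ->; rewrite irr_e. Qed.

Lemma card_edge (f : {set T}) : f \in edges e -> #|f| = 2.
Proof. by case/edgesP=> x [y [/edge_neq nxy ->]]; rewrite cards2 nxy. Qed.

Lemma trianglesP (t : {set T}) :
  reflect (#|t| = 3 /\ {in t &, forall x y, x != y -> e x y}) (t \in triangles e).
Proof.
rewrite inE; apply: (iffP andP) => [[/eqP-> H]|[-> H]]; split=> //.
  by move=> x y xt yt; move/forall_inP/(_ x xt)/forall_inP/(_ y yt)/implyP: H.
by apply/forall_inP=> x xt; apply/forall_inP=> y yt; apply/implyP; exact: H.
Qed.

(** The label of a vertex is its [enum_rank]. If two triangles of one class share an edge, the ranks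
    of their third vertices are congruent modulo n, hence equal. *)
Lemma card_triangles_le_nu : #|triangles e| <= #|T| * nu e.
Proof.
pose lab (t : {set T}) := \sum_(x in t) enum_rank x.
case: (posnP #|T|) => [T0|T_gt0].
  rewrite T0 leqn0 cards_eq0; apply/set0Pn=> -[t /trianglesP[ct _]].
  by have := max_card (mem t); rewrite ct T0.
pose col t : 'I_#|T| := Ordinal (ltn_pmod (lab t) T_gt0).
have pack c : triangle_packing e [set t in triangles e | col t == c].
  apply/andP; split; first by apply/subsetP=> t; rewrite inE => /andP[].
  apply/forall_inP=> t1; rewrite inE => /andP[/trianglesP[c1 _] /eqP col1].
  apply/forall_inP=> t2; rewrite inE => /andP[/trianglesP[c2 _] /eqP col2].
  apply/implyP; apply: contraR => /pred0Pn[f /= /andP[]].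
  rewrite !(in_set (fun f => _ && _)) => /andP[fE f1] /andP[_ f2]; have cf := card_edge fE.
  have third (t : {set T}) : #|t| = 3 -> f \subset t -> exists2 z, t = z |: f & lab t = lab f + enum_rank z.
    move=> ct sft; have := cardsID f t; rewrite (setIidPr sft) cf ct => c1f.
    have /cards1P[z zE] : #|t :\: f| == 1 by apply/eqP; lia.
    exists z; first by rewrite -(setID t f) (setIidPr sft) zE setUC.
    by rewrite /lab (big_setID f) (setIidPr sft) zE big_set1.
  have [z1 def1 lab1] := third _ c1 f1; have [z2 def2 lab2] := third _ c2 f2.
  suff /enum_rank_inj eqz : enum_rank z1 = enum_rank z2 by rewrite def1 def2 eqz.
  apply/val_inj; rewrite /= -[LHS](@modn_small _ #|T|) // -[RHS](@modn_small _ #|T|) //.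
  apply/eqP; rewrite -(eqn_modDl (lab f)) -lab1 -lab2.
  by have /(congr1 val)/= -> := etrans col1 (esym col2).
rewrite -sum1_card (partition_big col xpredT) //= -[leqRHS]/(_ * _).
rewrite -[X in X * _]card_ord -sum_nat_const; apply: leq_sum => c _.
by rewrite sum1dep_card; exact: (leq_bigmax_cond _ (pack c)).
Qed.

(** The slack [#|T|] comes from integrality: it suffices that tau < 2 nu + 1, and this is multiplied
    by n. *)
Lemma tau_le_2nu :
  0 < #|T| -> #|T| * tau e < 2 * #|triangles e| + #|T| -> tau e <= 2 * nu e.
Proof.
move=> n_gt0 lt_tau; rewrite -ltnS -(ltn_pmul2l n_gt0) mulnS addnC mulnCA.
by rewrite (leq_trans lt_tau) // leq_add2r leq_mul2l card_triangles_le_nu orbT.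
Qed.

Lemma tau_le (F : {set {set T}}) : triangle_hitting e F -> tau e <= #|F|.
Proof. exact: bigminn_le. Qed.

Lemma min_degree_le x : min_degree e <= degree e x.
Proof. exact: bigminn_le. Qed.

(* The remaining graph is bipartite, with parts [X] and [~: X]. *)
Lemma tau_le_monochromatic (X : {set T}) :
  tau e <= #|[set f in edges e | (f \subset X) || (f \subset ~: X)]|.
Proof.
apply: tau_le; apply/andP; split; first by apply/subsetP=> f; rewrite inE => /andP[].
rewrite /triangle_free -subset0; apply/subsetP=> t.
case/setIdP=> ct /forall_inP tE.
(* Two vertices of [t] on one side would span a removed edge, so the two sides hold at most two of
   its three vertices. *)
have mono Y : (Y = X) \/ (Y = ~: X) -> #|t :&: Y| <= 1.
  move=> defY; rewrite leqNgt; apply/negP=> /card_gt1P[x [y [/setIP[xt xY] /setIP[yt yY] nxy]]].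
  move: (tE x xt) => /forall_inP/(_ y yt); rewrite nxy /= => /andP[exy].
  rewrite inE; have -> : [set x; y] \in edges e by apply/edgesP; exists x, y.
  have : [set x; y] \subset Y by rewrite subUset !sub1set xY.
  by case: defY => -> ->; rewrite ?orbT.
have := cardsID X t; rewrite setDE (eqP ct).
by have := mono X (or_introl erefl); have := mono _ (or_intror erefl); lia.
Qed.

(** * Triangle counts and hittings in split graphs *)

Section Split.
Variables K S : {set T}.
Hypothesis split_e : split_graph e K S.

Let nbrs x := [set y | e x y].

Lemma split_notin x : (x \in S) = (x \notin K).
Proof.
case: split_e => _ defT; rewrite -setI_eq0 => /eqP KS0 _ _.
have := in_setT x; have := in_set0 x; rewrite -defT -KS0 !inE.
by case: (x \in K); case: (x \in S).
Qed.

Lemma card_split : #|K| + #|S| = #|T|.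
Proof.
rewrite -[RHS](cardsC K); congr (_ + _); apply: eq_card => x.
by rewrite inE split_notin.
Qed.

Lemma nbrs_sub s : s \in S -> nbrs s \subset K.
Proof.
case: split_e => _ _ _ _ indS sS; apply/subsetP=> y; rewrite inE.
by apply: contraTT; rewrite -split_notin => /(indS _ _ sS).
Qed.

(** All neighbours of a vertex of S lie in the clique K, so any two of them form a triangle with
    it. *)
Lemma card_triangles_split :
  'C(#|K|, 3) + \sum_(s in S) 'C(degree e s, 2) <= #|triangles e|.
Proof.
case: split_e => _ _ _ clK indS.
have sum_bool (U : finType) (P Q : pred U) : \sum_(t | P t) Q t = #|[set t | P t && Q t]|.
  by rewrite -sum1dep_card big_mkcondr.
(* No triangle is counted twice: one inside K has no vertex in S, and independence allows any other
   at most one. *)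
apply: (@leq_trans (\sum_(t in triangles e) ((t \subset K) + \sum_(s in S) (s \in t)))); last first.
  rewrite -sum1_card; apply: leq_sum => t /trianglesP[_ tE].
  have [tK|_] := boolP (t \subset K).
    rewrite big1 // => s; rewrite split_notin => sK.
    by case: (boolP (s \in t)) => // /(subsetP tK); rewrite (negPf sK).
  rewrite sum_bool leqNgt; apply/negP=> /card_gt1P[x [y []]].
  rewrite !inE => /andP[xS xt] /andP[yS yt] /(tE _ _ xt yt).
  exact/negP/indS.
rewrite big_split exchange_big /=; apply: leq_add; last apply: leq_sum => s sS.
  rewrite sum_bool -cards_draws; apply: subset_leq_card; apply/subsetP=> t.
  rewrite inE => /andP[tK /eqP ct]; rewrite inE tK andbT; apply/trianglesP; split=> // x y xt yt.
  by apply: clK; apply: (subsetP tK).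
rewrite sum_bool /degree -cards_draws -(card_in_imset (f := fun B => s |: B)).
  apply: subset_leq_card; apply/subsetP=> _ /imsetP[B + ->].
  rewrite inE => /andP[BN /eqP cB]; rewrite inE setU11 andbT.
  have sB : s \notin B by apply/negP=> /(subsetP BN); rewrite inE irr_e.
  apply/trianglesP; split=> [|x y]; first by rewrite cardsU1 sB cB.
  have adjB z : z \in B -> e s z by move=> /(subsetP BN); rewrite inE.
  have BK := subset_trans BN (nbrs_sub sS).
  rewrite !inE => /predU1P[->|xB] /predU1P[->|yB]; rewrite ?eqxx // => nxy.
  - exact: adjB.
  - by rewrite sym_e adjB.
  - by apply: clK nxy; apply: (subsetP BK).
move=> B1 B2; rewrite !(in_set (fun B => _ && _)) => /andP[B1N _] /andP[B2N _] eqB.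
have notN (B : {set T}) : B \subset nbrs s -> (s |: B) :\ s = B.
  by move=> BN; apply: setU1K; apply/negP=> /(subsetP BN); rewrite inE irr_e.
by have := congr1 (fun B => B :\ s) eqB; rewrite !notN.
Qed.

(** Once the edges inside K are deleted, a triangle would have at most one vertex in K and at most
    one in S. *)
Lemma tau_le_clique : tau e <= 'C(#|K|, 2).
Proof.
case: split_e => _ _ _ _ indS.
apply: (@leq_trans #|[set f in edges e | f \subset K]|); last first.
  rewrite -cards_draws; apply: subset_leq_card; apply/subsetP=> f.
  by rewrite !(in_set (fun f => _ && _)) => /andP[/card_edge-> ->].
apply: tau_le; apply/andP; split; first by apply/subsetP=> f; rewrite inE => /andP[].
rewrite /triangle_free -subset0; apply/subsetP=> t.
case/setIdP=> ct /forall_inP tE.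
have small Y : (Y = K) \/ (Y = S) -> #|t :&: Y| <= 1.
  move=> defY; rewrite leqNgt; apply/negP=> /card_gt1P[x [y [/setIP[xt xY] /setIP[yt yY] nxy]]].
  move: (tE x xt) => /forall_inP/(_ y yt); rewrite nxy /= => /andP[exy].
  case: defY => defY; last by move: (indS x y); rewrite -defY exy => /(_ xY yY).
  rewrite inE; have -> : [set x; y] \in edges e by apply/edgesP; exists x, y.
  by rewrite subUset !sub1set -defY xY yY.
have := cardsID K t; have -> : t :\: K = t :&: S.
  by apply/setP=> x; rewrite !inE split_notin andbC.
by rewrite (eqP ct); have := small K (or_introl erefl); have := small S (or_intror erefl); lia.
Qed.

(** Put each s on the side, [A] or its complement in K, where it has fewer neighbours. A
    monochromatic edge then lies inside one part of K or joins some s to its own side. *)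
Lemma tau_le_bipartition (A : {set T}) : A \subset K ->
  tau e <= 'C(#|A|, 2) + 'C(#|K :\: A|, 2) +
    \sum_(s in S) minn #|nbrs s :&: A| #|nbrs s :\: A|.
Proof.
case: split_e => _ _ _ _ indS AK.
pose inX s := #|nbrs s :&: A| <= #|nbrs s :\: A|.
pose side s := if inX s then nbrs s :&: A else nbrs s :\: A.
apply: leq_trans (tau_le_monochromatic (A :|: [set s in S | inX s])) _.
set X := _ :|: _.
pose draws (B : {set T}) := [set f : {set T} | f \subset B & #|f| == 2].
pose stars := \bigcup_(s in S) [set [set s; x] | x in side s].
have XK x : x \in K -> (x \in X) = (x \in A).
  by move=> xK; rewrite !inE split_notin xK orbF.
have XS s : s \in S -> (s \in X) = inX s.
  move=> sS; rewrite !inE sS /=; case: (boolP (s \in A)) => // /(subsetP AK) sK.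
  by move: sS; rewrite split_notin sK.
have starE s y : s \in S -> e s y ->
    ([set s; y] \subset X) || ([set s; y] \subset ~: X) -> [set s; y] \in stars.
  move=> sS esy mono; apply/bigcupP; exists s => //; apply/imsetP; exists y => //.
  have yK : y \in K by apply: (subsetP (nbrs_sub sS)); rewrite inE.
  move: mono; rewrite !subUset !sub1set !in_setC (XK y yK) (XS s sS) /side.
  by case: (inX s); rewrite !inE esy /= ?andbT ?orbF.
apply: (@leq_trans #|draws A :|: draws (K :\: A) :|: stars|).
  apply: subset_leq_card; apply/subsetP=> f; rewrite inE => /andP[/[dup] fE /edgesP[x [y [exy deff]]] mono].
  case: (boolP (x \in S)) => [xS|]; first by rewrite inE deff starE ?orbT // -deff.
  case: (boolP (y \in S)) => [yS _|]; first by rewrite inE deff setUC starE ?orbT // 1?sym_e // setUC -deff.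
  rewrite !split_notin !negbK => yK xK.
  rewrite !(in_setU, in_set (fun f => _ && _)) (card_edge fE) eqxx !andbT.
  move: mono; rewrite deff !subUset !sub1set !in_setD !in_setC !XK // xK yK !andbT.
  by case/orP=> ->; rewrite ?orbT.
apply: leq_trans (leq_card_setU _ _) _; rewrite -(cards_draws A) -(cards_draws (K :\: A)).
apply: leq_add; first exact: leq_card_setU.
apply: leq_trans (leq_card_bigcup _ _) _; apply: leq_sum => s _.
apply: leq_trans (leq_imset_card _ _) _.
by rewrite /side /inX; case: ifP => [|/negbT]; lia.
Qed.

Lemma card_triangles_ge D : {in S, forall s, D <= degree e s} ->
  2 * 'C(#|K|, 3) + #|S| * (D * D.-1) <= 2 * #|triangles e|.
Proof.
move=> leD; apply: leq_trans (leq_mul (leqnn 2) card_triangles_split).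
rewrite mulnDr leq_add2l -sum_nat_const big_distrr /=; apply: leq_sum => s /leD Dd.
by rewrite mul_2bin2 leq_mul // -!subn1 leq_sub2r.
Qed.

(* Going from degree [D] to [D + 1] raises the bound on [n tau] by at most [n],
   and the one on [2 n nu] by [2 D >= n]; hence one may take all degrees equal
   to [D]. *)
Lemma tau_le_2nu_of_bipartition (A : {set T}) (G : T -> nat) D :
  A \subset K -> #|T| <= 2 * D -> 0 < #|T| -> {in S, forall s, D <= degree e s} ->
  {in S, forall s, minn #|nbrs s :&: A| #|nbrs s :\: A| <= G s + (degree e s - D)} ->
  #|T| * ('C(#|A|, 2) + 'C(#|K :\: A|, 2) + \sum_(s in S) G s)
    < 2 * 'C(#|K|, 3) + #|S| * (D * D.-1) + #|T| ->
  tau e <= 2 * nu e.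
Proof.
move=> AK n2D n_gt0 leD sideG bound; apply: tau_le_2nu => //.
have sum_le : #|T| * (\sum_(s in S) minn #|nbrs s :&: A| #|nbrs s :\: A|) + #|S| * (D * D.-1)
    <= #|T| * (\sum_(s in S) G s) + 2 * \sum_(s in S) 'C(degree e s, 2).
  rewrite -sum_nat_const !big_distrr -!big_split /=; apply: leq_sum => s sS.
  have Dd := leD s sS; have := leq_mul (leqnn #|T|) (sideG s sS).
  have := leq_mul n2D (leqnn (degree e s - D)); rewrite mul_2bin2 mulnDr.
  (* The right side exceeds the left by x (x - 1). *)
  have grow x : D * D.-1 + 2 * D * x <= (D + x) * (D + x).-1.
    case: (D) x => [|D'] [|x]; rewrite ?muln0 ?addn0 // ?add0n ?addSn ?[_.+1.-1]/=; nia.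
  have := grow (degree e s - D); rewrite subnKC //.
  move: (D * D.-1) (degree e s * _) (degree e s - D) (minn _ _) => P Q x m.
  by move: (_ * m) (_ * G s) (2 * D * x) (_ * x) => a b c d; lia.
have le_tau := leq_mul (leqnn #|T|) (tau_le_bipartition AK).
have le_tri := card_triangles_split.
move: sum_le bound le_tau le_tri; rewrite !mulnDr.
move: (\sum_(s in S) G s) (\sum_(s in S) 'C(degree e s, 2)) => g c.
move: (\sum_(s in S) minn #|nbrs s :&: A| #|nbrs s :\: A|) => m.
by move: (_ * m) (_ * g) (#|S| * _) (_ * tau e) (_ * 'C(#|A|, _)) (_ * 'C(#|K :\: A|, _)); lia.
Qed.

End Split.

End Graph.

(** * The three numerical cases and the choice of [A] *)

Theorem theorem1 (T : finType) (e : rel T) (K S : {set T}) (n : nat)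
    (hn : #|T| = n) (hG : split_graph e K S)
    (hdelta : 3 * n <= 5 * min_degree e) :
  tau e <= 2 * nu e.
Proof.
have [simple_e _ _ _ _] := hG; have cKS := card_split hG.
(* [tau_le_2nu] needs a vertex; without one, tau is at most C(0, 2) = 0. *)
have [n0|n_gt0] := posnP #|T|.
  have K0 : #|K| = 0 by lia.
  by have := tau_le_clique simple_e hG; rewrite K0 leqn0 => /eqP->.
pose D := (3 * #|T| + 4) %/ 5; pose h := #|K|./2.
have leD s : D <= degree e s by have := min_degree_le e s; rewrite /D; lia.
(* If S is empty, K is the whole vertex set; otherwise K contains all neighbours of a vertex of
   S. *)
have DK : D <= #|K|.
  have [S0|[s sS]] := set_0Vmem S; first by move: cKS; rewrite S0 cards0 /D; lia.
  exact: leq_trans (leD s) (subset_leq_card (nbrs_sub hG sS)).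
have n2D : #|T| <= 2 * D by rewrite /D; lia.
(* The smaller part has at most floor(d / 2) vertices, and each step of d above D raises this by at
   most one. *)
have side_half (A : {set T}) s :
    minn #|[set y | e s y] :&: A| #|[set y | e s y] :\: A| <= D./2 + (degree e s - D).
  by have := cardsID A [set y | e s y]; have := leD s; rewrite -/(degree e s); lia.
have card_compl (A : {set T}) : A \subset K -> #|A| = h -> #|K :\: A| = #|K| - h.
  by move=> AK <-; have := cardsID A K; rewrite (setIidPr AK); lia.
have [clique_lt|half_lt|[S3 D3 shift_lt]] := bipartition_arith cKS erefl DK erefl n_gt0.
- apply: tau_le_2nu => //.
  rewrite (leq_ltn_trans (leq_mul (leqnn _) (tau_le_clique simple_e hG))) //.
  by rewrite (leq_trans clique_lt) // leq_add2r (card_triangles_ge simple_e hG) // => s _.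
- have [A [_ AK cA]] : exists A : {set T}, [/\ set0 \subset A, A \subset K & #|A| = h].
    by apply: (@superset_of_card _ set0 K); rewrite ?sub0set // cards0 /h; lia.
  apply: (tau_le_2nu_of_bipartition (G := fun=> D./2) simple_e hG AK n2D n_gt0) => //.
  by rewrite cA card_compl // sum_nat_const.
rewrite -/D -/h in D3 shift_lt.
have [S0 [_ S0S cS0]] : exists S0 : {set T}, [/\ set0 \subset S0, S0 \subset S & #|S0| = 3].
  by apply: (@superset_of_card _ set0 S); rewrite ?sub0set // cards0.
pose miss s := K :\: [set y | e s y].
have card_miss s : s \in S -> #|miss s| = #|K| - degree e s.
  move=> sS; have := cardsID [set y | e s y] K.
  by rewrite (setIidPr (nbrs_sub hG sS)) -/(degree e s) -/(miss s); lia.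
(* Each [miss s] has at most |K| - D vertices, so by [D3] the union of three of them fits into a set
   of size h. *)
have [A [missA AK cA]] : exists A : {set T}, [/\ \bigcup_(s in S0) miss s \subset A, A \subset K & #|A| = h].
  apply: (@superset_of_card _ (\bigcup_(s in S0) miss s) K); first by apply/bigcupsP=> s _; apply: subsetDl.
  rewrite [h <= _](_ : _ = true); last by rewrite /h; lia.
  rewrite andbT (leq_trans (leq_card_bigcup _ _)) //.
  apply: (@leq_trans (\sum_(s in S0) (#|K| - D))); last by rewrite sum_nat_const cS0.
  by apply: leq_sum => s /(subsetP S0S) sS; rewrite card_miss // leq_sub2l.
apply: (tau_le_2nu_of_bipartition
  (G := fun s => if s \in S0 then h - (#|K| - D) else D./2) simple_e hG AK n2D n_gt0) => // [s sS|].
  case: ifP => // sS0.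
  (* All |K| - d non-neighbours of s in K lie in [A], so s sees only h - (|K| - d) = h - (|K| - D) +
     (d - D) vertices of [A]. *)
  have missAD : miss s \subset A :\: [set y | e s y].
    by rewrite subsetD (subset_trans (bigcup_sup s sS0) missA) /miss disjoint_sym -setI_eq0 setIDA setDIl setDv set0I eqxx.
  have := cardsID [set y | e s y] A; have := subset_leq_card missAD.
  have := subset_leq_card (nbrs_sub hG sS); rewrite -/(degree e s) card_miss // cA setIC.
  by move: D3 (leD s); rewrite -/h -/D; lia.
rewrite cA card_compl // (big_setID S0) /= (setIidPr S0S).
rewrite (eq_bigr (fun=> h - (#|K| - D))) => [|s ->] //.
rewrite [X in _ + (_ + X)](eq_bigr (fun=> D./2)) => [|s /setDP[_ /negPf->]] //.
by rewrite !sum_nat_const cardsD (setIidPr S0S) cS0.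
Qed.
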